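(* Let $R=k[x_0,\ldots,x_n]$ be a polynomial ring over a field $k$ of any characteristic, let $1\le c<s$ be integers, and let $\mathcal F=\{F_1,\ldots,F_s\}$ be a set of $s$ forms in $R$ such that any $c+1$ of them form a regular sequence. Let $I_{c,\mathcal F}=\bigcap_{1\le j_1<\cdots<j_c\le s}(F_{j_1},\ldots,F_{j_c})$. For any $m\geq 1$, a minimal generating set of $I_{c,\mathcal F}^{(m)}$ is given by the set $\mathbf G_{c,(m)}$ of all monomials $M$ in $\mathcal F$ such that $\mathrm{Sdeg}_c(M)=m$ and $|\mathrm{supp}(M^{(j)})|\ge s+1-c$ for every factor $M^{(j)}$ in the normal form of $M$.
   Context: For a homogeneous ideal $I\subseteq R$ and $m\ge 1$, the symbolic power is $I^{(m)}=\bigcap_{P\in \mathrm{Ass}(R/I)}(I^mR_P\cap R)$. A monomial in $\mathcal F$ is a product (possibly with repetition) of elements of $\mathcal F$. Under the stated hypothesis on $\mathcal F$, every monomial $M$ in $\mathcal F$ is a product of elements of $\mathcal F$ in only one way up to order; $\mathrm{supp}(M)\subseteq\mathcal F$ is the set of elements occurring in it, and $M$ is squarefree if it is a product of distinct elements of $\mathcal F$. Every monomial $M$ has a unique normal form $M=M^{(1)}\cdots M^{(t)}$, where the $M^{(j)}$ are squarefree monomials in $\mathcal F$ with $\emptyset\ne\mathrm{supp}(M^{(i+1)})\subseteq\mathrm{supp}(M^{(i)})$ for all $1\le i\le t-1$. The symbolic degree of $M$ is $\mathrm{Sdeg}_c(M)=\sum_{i=1}^t\max\{0,\,c-s+|\mathrm{supp}(M^{(i)})|\}$.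 *)

(* Defs.v *)
From HB Require Import structures.
From mathcomp Require Import all_boot all_order all_algebra.
From mathcomp Require Import fraction.
From mathcomp Require Import mpoly.

Set Implicit Arguments.
Unset Strict Implicit.
Unset Printing Implicit Defensive.

Import GRing.Theory.
Local Open Scope ring_scope.

(* Ideals and sets of polynomials are Prop-valued predicates; equality of
   ideals is pointwise equivalence. *)

Definition ideal_gen (R : comNzRingType) (G : R -> Prop) (f : R) : Prop :=
  exists l : seq (R * R),
    (forall p, p \in l -> G p.2) /\ f = \sum_(p <- l) p.1 * p.2.

Definition ideal_pow (R : comNzRingType) (I : R -> Prop) (m : nat) : R -> Prop :=
  ideal_gen (fun f => exists u : 'I_m -> R,
    (forall i, I (u i)) /\ f = \prod_(i < m) u i).

Definition is_ideal (R : comNzRingType) (I : R -> Prop) : Prop :=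
  [/\ I 0,
      forall f g, I f -> I g -> I (f + g)
    & forall f g, I g -> I (f * g)].

Definition prime_ideal (R : comNzRingType) (P : R -> Prop) : Prop :=
  [/\ is_ideal P,
      ~ P 1
    & forall f g, P (f * g) -> P f \/ P g].

(* P belongs to Ass(R/I): P is prime and is the annihilator of the class of
   some f in R/I. *)
Definition associated_prime (R : comNzRingType) (I P : R -> Prop) : Prop :=
  prime_ideal P /\ exists f, forall g, P g <-> I (g * f).

(* The localization of a domain R at a prime P, as a subset of Frac R. *)
Definition localization (R : idomainType) (P : R -> Prop)
    (x : {fraction R}) : Prop :=
  exists a b : R, ~ P b /\ x = tofrac a / tofrac b.

(* The ideal J R_P of R_P. *)
Definition extended_ideal (R : idomainType) (P J : R -> Prop)
    (x : {fraction R}) : Prop :=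
  exists l : seq ({fraction R} * R),
    (forall p, p \in l -> localization P p.1 /\ J p.2) /\
    x = \sum_(p <- l) p.1 * tofrac p.2.

Definition symbolic_power (R : idomainType) (I : R -> Prop) (m : nat)
    (f : R) : Prop :=
  forall P : R -> Prop, associated_prime I P ->
    extended_ideal P (ideal_pow I m) (tofrac f).

Definition regular_sequence (R : comNzRingType) (u : seq R) : Prop :=
  (forall (j : nat) (g : R), (j < size u)%N ->
     ideal_gen (fun h => h \in take j u) (g * u`_j) ->
     ideal_gen (fun h => h \in take j u) g) /\
  ~ ideal_gen (fun h => h \in u) 1.

(* G generates J and no proper subset of G does. *)
Definition minimal_generating_set (R : comNzRingType) (J G : R -> Prop) : Prop :=
  (forall f, J f <-> ideal_gen G f) /\
  (forall H : R -> Prop, (forall g, H g -> G g) ->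
     (forall f, J f <-> ideal_gen H f) -> forall g, G g -> H g).

(* The intersection of all ideals generated by c of the forms. *)
Definition codim_ideal (R : comNzRingType) (s c : nat) (F : 'I_s -> R)
    (f : R) : Prop :=
  forall S : {set 'I_s}, #|S| = c ->
    ideal_gen (fun h => exists2 i, i \in S & h = F i) f.

Definition monomial_in (R : comNzRingType) (s : nat) (F : 'I_s -> R)
    (M : R) : Prop :=
  exists w : seq 'I_s, M = \prod_(i <- w) F i.

(* A squarefree monomial is encoded by the set of indices of its support, so
   that L lists supp(M^(1)), ..., supp(M^(t)). *)
Definition normal_form (R : comNzRingType) (s : nat) (F : 'I_s -> R)
    (M : R) (L : seq {set 'I_s}) : Prop :=
  [/\ forall A, A \in L -> A != set0,
      sorted (fun A B : {set 'I_s} => B \subset A) L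
    & M = \prod_(A <- L) \prod_(i in A) F i].

(* Truncated subtraction renders max(0, c - s + #|A|). *)
Definition Sdeg (s c : nat) (L : seq {set 'I_s}) : nat :=
  (\sum_(A <- L) (c + #|A| - s))%N.

(* The normal form of a monomial is unique when any two of the F i form a
   regular sequence, so L is determined by M below. *)
Definition symbolic_generators (R : comNzRingType) (s c : nat)
    (F : 'I_s -> R) (m : nat) (M : R) : Prop :=
  monomial_in F M /\
  exists L : seq {set 'I_s},
    [/\ normal_form F M L,
        Sdeg c L = m
      & forall A, A \in L -> (s + 1 - c <= #|A|)%N].

(* Main.v *)
Require Import Defs.
From HB Require Import structures.
From mathcomp Require Import all_boot all_order all_algebra.
From mathcomp Require Import fraction.
From mathcomp Require Import mpoly.
From mathcomp Require Import zify ring.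
From Stdlib Require Import ClassicalEpsilon.

Set Implicit Arguments.
Unset Strict Implicit.
Unset Printing Implicit Defensive.

Import Order.TTheory GRing.Theory.
Local Open Scope ring_scope.

(** Write u^e for the monomial in the forms with exponent vector e, and e_S
    for the sum of the exponents over a set S of indices.

    The normal form of u^e consists of the level sets of e. Hence the symbolic
    degree of u^e is the sum of the c smallest exponents, that is, the minimum
    of e_S over the c-sets S. The theorem says that the symbolic power
    consists of the combinations of the u^e with e_S >= m for all c-sets S,
    and that the divisibility-minimal monomials among them are irredundant.

    The basic tool is that at most c of the forms behave like independent
    variables: colons of monomial ideals by monomials are computed on exponents
    ([mon_ideal_colon]), so a coefficient in a relation among monomials lies in
    the ideal generated by these forms ([mon_ideal_coef]).

    - The ideal of the u^e with e_S >= m for all S is the intersection of the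
      ideals (u_i : i in S)^m ([star_intersection]). All c-sets together
      involve more than c forms, so the intersection cannot be read off from
      exponents. For weights w one considers more generally the conditions
      e_S + w_S >= m, and reduces modulo a form u_x of least weight: there the
      conditions on the c-sets through x imply the others and involve only
      c - 1 further forms. What is left over is divisible by u_x, and dividing
      by u_x raises the weight of x.

    - The symbolic power is the intersection of the (u_i : i in S)^m
      ([symbolic_power_star]). A prime P associated to the intersection I
      contains u_i only for i in some fixed S; the product h of the other forms
      is a unit at P and h u_i lies in I for i in S, which gives one inclusion.
      Conversely, let f have order i < m along S, with an initial coefficient r
      outside (u_i : i in S). The ring is Noetherian, so the multipliers of r
      into (u_i : i in S) lie in an associated prime P of that ideal, and P
      is also associated to I. If b f lies in I^m, then b r lies in
      (u_i : i in S), so b lies in P: f is not in I^m at P.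

    - In an exponent vector minimal for the conditions, an exchange argument
      shows that the maximal value is attained outside some S with e_S = m and
      at a member of S, hence at least s + 1 - c times
      ([generator_form_below]). Conversely, for a generator choose S with
      e_S = m. Another generator whose exponents on S are not larger has the
      same exponents on S; the common maximum occurs on S, and both take it
      everywhere outside S ([generator_form_minimal]). As the forms in S
      behave like variables, no generator is a combination of the others. *)

(** * Ideals given by generators *)

Section Ideals.

Variable R : comNzRingType.
Implicit Types (f g h : R) (G H J : R -> Prop).

Lemma ideal_gen_is_ideal G : is_ideal (ideal_gen G).
Proof.
split; first by exists [::]; split=> //; rewrite big_nil.
- move=> f g [l [lG ->]] [l' [l'G ->]]; exists (l ++ l'); split.
    by move=> p; rewrite mem_cat => /orP[/lG|/l'G].
  by rewrite big_cat.
- move=> f g [l [lG ->]]; exists [seq (f * p.1, p.2) | p <- l]; split.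
    by move=> p /mapP[q /lG ? ->].
  by rewrite big_map mulr_sumr; apply: eq_bigr => p _; rewrite mulrA.
Qed.

Lemma ideal_gen_base G g : G g -> ideal_gen G g.
Proof.
move=> Gg; exists [:: (1, g)]; split; last by rewrite big_seq1 mul1r.
by move=> p; rewrite inE => /eqP->.
Qed.

Lemma ideal_sum J (T : eqType) (r : seq T) (E : T -> R) :
  is_ideal J -> (forall i, i \in r -> J (E i)) -> J (\sum_(i <- r) E i).
Proof.
case=> J0 JD _; elim: r => [|i r IHr] Jr; first by rewrite big_nil.
rewrite big_cons; apply: JD; first by apply: Jr; rewrite mem_head.
by apply: IHr => j rj; apply: Jr; rewrite inE rj orbT.
Qed.

(** Most inclusions below are checked on generators through this universal
    property, applied to a well-chosen ideal [J]. *)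
Lemma ideal_gen_least J G :
  is_ideal J -> (forall g, G g -> J g) -> forall f, ideal_gen G f -> J f.
Proof.
move=> idJ GJ f [l [lG ->]]; apply: ideal_sum => // p /lG/GJ.
by case: idJ => _ _; apply.
Qed.

Lemma ideal_gen_mono G H :
  (forall g, G g -> H g) -> forall f, ideal_gen G f -> ideal_gen H f.
Proof.
move=> GH; apply: ideal_gen_least; first exact: ideal_gen_is_ideal.
by move=> g /GH; apply: ideal_gen_base.
Qed.

Lemma ideal_mulr J f g : is_ideal J -> J f -> J (f * g).
Proof. by case=> _ _ JM Jf; rewrite mulrC; apply: JM. Qed.

Lemma ideal_subr J f g : is_ideal J -> J f -> J g -> J (f - g).
Proof. by case=> _ JD JM Jf Jg; rewrite -mulN1r; apply/JD/JM. Qed.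

Lemma ideal_add_cancel J f g : is_ideal J -> J (f + g) -> J f -> J g.
Proof.
move=> idJ Jfg Jf; have -> : g = (f + g) - f by ring.
exact: ideal_subr.
Qed.

Lemma colon_is_ideal J g : is_ideal J -> is_ideal (fun f => J (f * g)).
Proof.
case=> J0 JD JM; split; first by rewrite mul0r.
- by move=> f h Jf Jh; rewrite mulrDl; apply: JD.
- by move=> f h Jh; rewrite -mulrA; apply: JM.
Qed.

End Ideals.

(** * Monomials in a family of ring elements *)

Section Monomials.

Variables (R : comNzRingType) (s : nat) (u : 'I_s -> R).
Implicit Types (e a b : 'X_{1..s}) (L : pred 'X_{1..s}) (f g h r : R).

Definition mon e : R := \prod_i u i ^+ e i.

Definition mon_ideal L : R -> Prop :=
  ideal_gen (fun h => exists2 e, L e & h = mon e).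

Lemma mon0 : mon 0%MM = 1.
Proof. by rewrite /mon big1 // => i _; rewrite mnm0E. Qed.

Lemma monD a b : mon (a + b)%MM = mon a * mon b.
Proof. by rewrite /mon -big_split; apply: eq_bigr => i _; rewrite mnmDE exprD. Qed.

Lemma monU i : mon U_(i)%MM = u i.
Proof.
rewrite /mon (bigD1 i) //= mnm1E eqxx expr1 big1 ?mulr1 // => j /negbTE ji.
by rewrite mnm1E eq_sym ji.
Qed.

Lemma mon_split a e : (a <= e)%MM -> mon e = mon (e - a)%MM * mon a.
Proof. by move=> ae; rewrite -monD submK. Qed.

Lemma lemU i e : (U_(i) <= e)%MM = (0 < e i)%N.
Proof. by rewrite lep1mP lt0n. Qed.

Lemma mon_ideal_is_ideal L : is_ideal (mon_ideal L).
Proof. exact: ideal_gen_is_ideal. Qed.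
Hint Resolve mon_ideal_is_ideal : core.

Lemma mon_in_mon_ideal L e : L e -> mon_ideal L (mon e).
Proof. by move=> Le; apply: ideal_gen_base; exists e. Qed.

Lemma mon_ideal_least L J :
  is_ideal J -> (forall e, L e -> J (mon e)) -> forall f, mon_ideal L f -> J f.
Proof. by move=> idJ LJ; apply: ideal_gen_least => // _ [e Le ->]; apply: LJ. Qed.

Lemma mon_ideal_mono L L' :
  (forall e, L e -> L' e) -> forall f, mon_ideal L f -> mon_ideal L' f.
Proof.
by move=> LL'; apply: mon_ideal_least => // e /LL'; apply: mon_in_mon_ideal.
Qed.

Lemma mon_ideal_all L f : L 0%MM -> mon_ideal L f.
Proof.
move=> L0; rewrite -[f]mulr1 -mon0; case: (mon_ideal_is_ideal L) => _ _; apply.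
exact: mon_in_mon_ideal.
Qed.

Lemma mon_idealM L1 L2 L f g :
    (forall e e', L1 e -> L2 e' -> L (e + e')%MM) ->
  mon_ideal L1 f -> mon_ideal L2 g -> mon_ideal L (f * g).
Proof.
move=> LD Lf Lg; move: f Lf; apply: mon_ideal_least.
  exact: colon_is_ideal.
move=> e Le; rewrite mulrC; move: g Lg; apply: mon_ideal_least.
  exact: colon_is_ideal.
by move=> e' Le'; rewrite mulrC -monD; apply: mon_in_mon_ideal; apply: LD.
Qed.

Lemma mon_idealU L L' x f :
    (forall e, L e -> L' (e + U_(x))%MM) ->
  mon_ideal L f -> mon_ideal L' (u x * f).
Proof.
move=> LL'; rewrite -(monU x) mulrC; move: f; apply: mon_ideal_least.
  exact: colon_is_ideal.
by move=> e /LL' L'e; rewrite -monD; apply: mon_in_mon_ideal.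
Qed.

(** Coefficients with respect to monomials in [u] are not unique; the split is
    read off from a representation of [f], so [g] and [h] are mere choices. *)
Lemma mon_ideal_split L L0 L1 a f :
    (forall e, L e -> L0 e \/ (a <= e)%MM /\ L1 (e - a)%MM) ->
  mon_ideal L f ->
  exists g h, [/\ f = g + mon a * h, mon_ideal L0 g & mon_ideal L1 h].
Proof.
move=> Lsplit; move: f; apply: mon_ideal_least.
  have [[z0 D0 M0] [z1 D1 M1]] := (mon_ideal_is_ideal L0, mon_ideal_is_ideal L1).
  split; first by exists 0, 0; split; rewrite ?mulr0 ?addr0.
  - move=> _ _ [g [h [-> gL hL]]] [g' [h' [-> gL' hL']]].
    by exists (g + g'), (h + h'); split; [ring|apply: D0|apply: D1].
  - move=> k _ [g [h [-> gL hL]]].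
    by exists (k * g), (k * h); split; [ring|apply: M0|apply: M1].
move=> e /Lsplit[L0e|[ae L1e]].
  exists (mon e), 0; split; first by rewrite mulr0 addr0.
    exact: mon_in_mon_ideal.
  by case: (mon_ideal_is_ideal L1).
exists 0, (mon (e - a)%MM); split; first by rewrite add0r mulrC -mon_split.
  by case: (mon_ideal_is_ideal L0).
exact: mon_in_mon_ideal.
Qed.

(** ** Up-closed sets of exponents depending on some coordinates *)

(** Stability under multiplication by monomials and independence from the
    exponents outside [U], in one condition. With at most [c] elements in [U],
    these are the sets for which exponents can be trusted. *)
Definition upper_on (U : {set 'I_s}) L :=
  forall e e', (forall i, i \in U -> (e i <= e' i)%N) -> L e -> L e'.

Definition restrict (U : {set 'I_s}) e : 'X_{1..s} :=
  [multinom (if i \in U then e i else 0)%N | i < s].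

(** Provides the finitely many generators, involving only [U], whose total
    degree serves as induction measure. *)
Lemma mon_ideal_finite U L f :
    upper_on U L -> mon_ideal L f ->
  exists B : seq 'X_{1..s},
    [/\ forall b, b \in B -> L b,
        forall b, b \in B -> forall i, (0 < b i)%N -> i \in U
      & mon_ideal (fun e => has (fun b => (b <= e)%MM) B) f].
Proof.
move=> upL; move: f; apply: mon_ideal_least; first split.
- by exists [::]; split=> //; case: (mon_ideal_is_ideal xpred0).
- move=> f g [B [BL BU Bf]] [C [CL CU Cg]]; exists (B ++ C); split.
  + by move=> b; rewrite mem_cat => /orP[/BL|/CL].
  + by move=> b; rewrite mem_cat => /orP[/BU|/CU].
  + set K := fun e => _.
    case: (mon_ideal_is_ideal K) => _ KD _; apply: KD.
      by move: f Bf; apply: mon_ideal_mono => e; rewrite /K has_cat => ->.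
    by move: g Cg; apply: mon_ideal_mono => e; rewrite /K has_cat orbC => ->.
- move=> f g [B [BL BU Bf]]; exists B; split=> //.
  by case: (mon_ideal_is_ideal (fun e => has (fun b => (b <= e)%MM) B)) => _ _; apply.
move=> e Le; exists [:: restrict U e]; split.
- move=> b; rewrite inE => /eqP->; apply: upL Le => i iU.
  by rewrite mnmE iU.
- by move=> b; rewrite inE => /eqP-> i; rewrite mnmE; case: ifP.
- apply: mon_in_mon_ideal; rewrite /= orbF; apply/mnm_lepP => i.
  by rewrite mnmE; case: ifP.
Qed.

Definition vars_ideal (V : {set 'I_s}) : R -> Prop :=
  mon_ideal (fun e => [exists x in V, 0 < e x]%N).

Lemma vars_idealP (V : {set 'I_s}) f :
  vars_ideal V f <-> ideal_gen (fun h => exists2 i, i \in V & h = u i) f.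
Proof.
split; move: f.
  apply: mon_ideal_least; first exact: ideal_gen_is_ideal.
  move=> e /exists_inP[x xV]; rewrite -lemU => /mon_split->.
  case: (ideal_gen_is_ideal (fun h => exists2 i, i \in V & h = u i)) => _ _.
  by apply; rewrite monU; apply: ideal_gen_base; exists x.
apply: ideal_gen_least; first exact: mon_ideal_is_ideal.
move=> _ [x xV ->]; rewrite -monU; apply: mon_in_mon_ideal.
by apply/exists_inP; exists x => //; rewrite mnm1E eqxx.
Qed.

End Monomials.

#[global] Hint Resolve mon_ideal_is_ideal : core.

(** * Monomial ideals in a regular family *)

Section RegularFamily.

Variables (R : comNzRingType) (s : nat) (u : 'I_s -> R) (c : nat).
Implicit Types (e a b : 'X_{1..s}) (L : pred 'X_{1..s}) (f g h r : R).
Implicit Types (U V X : {set 'I_s}) (B : seq 'X_{1..s}).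

(** What the proofs use of the regularity of the sequences of [c + 1] members;
    it is symmetric in the members, so that they can be removed in any order. *)
Definition regular_family :=
  forall V j f, (#|V| <= c)%N -> j \notin V ->
    vars_ideal u V (u j * f) -> vars_ideal u V f.

Hypothesis u_reg : regular_family.

(** If [L] splits into a part [L0] modulo which [u x] is regular and a part
    divisible by [u x], then division by [u x] can be done on each part. *)
Lemma mon_ideal_colon_gen L L0 L1 x f :
    (forall e, L e -> L0 e \/ (U_(x) <= e)%MM /\ L1 (e - U_(x))%MM) ->
    (forall e, L0 e -> L1 e) ->
    (forall g, mon_ideal u L0 (u x * g) -> mon_ideal u L0 g) ->
  mon_ideal u L (u x * f) -> mon_ideal u L1 f.
Proof.
move=> Lsplit L01 L0reg /(mon_ideal_split Lsplit)[g [h [fgh L0g L1h]]].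
have -> : f = (f - h) + h by ring.
case: (mon_ideal_is_ideal u L1) => _ D1 _; apply: D1 => //.
apply: (mon_ideal_mono L01); apply: L0reg.
by rewrite mulrBr fgh monU addrK.
Qed.

(** The exponents of the ideal [(u_x : x in X) + (u^b : b in B)]. The set [X]
    stands for variables set to zero: working modulo [u_X] inside the ring
    avoids quotient rings. *)
Definition lower X B : pred 'X_{1..s} :=
  fun e => [exists x in X, 0 < e x]%N || has (fun b => (b <= e)%MM) B.

Definition supported U B := forall b, b \in B -> forall i, (0 < b i)%N -> i \in U.

Lemma lower_split X B x e :
    lower X B e ->
  lower X [seq b : 'X_{1..s} <- B | b x == 0%N] e \/
  (U_(x) <= e)%MM /\ lower X [seq (b - U_(x))%MM | b : 'X_{1..s} <- B] (e - U_(x))%MM.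
Proof.
case/orP=> [Xe|/hasP[b bB be]]; first by left; rewrite /lower Xe.
have [bx0|bx] := posnP (b x).
  by left; apply/orP; right; apply/hasP; exists b => //; rewrite mem_filter bx0 eqxx.
right; split; first by rewrite lemU; apply: leq_trans bx (mnm_lepP be x).
apply/orP; right; rewrite has_map; apply/hasP; exists b => //=.
by apply/mnm_lepP => i; rewrite !mnmBE leq_sub2r // (mnm_lepP be).
Qed.

Lemma lower_filter_sub X B x e :
    lower X [seq b : 'X_{1..s} <- B | b x == 0%N] e ->
  lower X [seq (b - U_(x))%MM | b : 'X_{1..s} <- B] e.
Proof.
case/orP=> [Xe|/hasP[b]]; first by rewrite /lower Xe.
rewrite mem_filter => /andP[/eqP bx0 bB] be.
apply/orP; right; rewrite has_map; apply/hasP; exists b => //=.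
exact: lepm_trans (lem_subr _ _) be.
Qed.

(** One variable [x] of [U] is peeled off at a time. Modulo [u x] the
    monomials involve fewer variables, so [f = g + u x * h] with [g] in the
    ideal. Then [u j * h] lies in the colon of the ideal by [u x], whose
    generators have smaller degree; that this colon is the expected one is the
    case of fewer variables, applied to [u x]. *)
Lemma lower_regular X U B j f :
    [disjoint U & X] -> (#|U| + #|X| <= c)%N -> j \notin U -> j \notin X ->
    supported U B ->
  mon_ideal u (lower X B) (u j * f) -> mon_ideal u (lower X B) f.
Proof.
have [n] := ubnP #|U|; elim: n => // n IHn in X U B j f *; rewrite ltnS => leUn.
have [k] := ubnP (\sum_(b <- B) mdeg b)%N.
elim: k => // k IHk in B f *; rewrite ltnS => leBk dUX leUXc jU jX BU Ljf.
have [/hasP[b bB b0]|B0] := boolP (has (fun b => b != 0%MM) B); last first.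
  case: B => [|b B] in B0 Ljf {BU leBk} *.
    have lowerE e : lower X [::] e -> [exists x in X, 0 < e x]%N.
      by rewrite /lower orbF.
    move/(mon_ideal_mono lowerE): Ljf.
    move/(u_reg (leq_trans (leq_addl _ _) leUXc) jX).
    by apply: mon_ideal_mono => e Xe; rewrite /lower Xe.
  move: B0; rewrite /= negb_or negbK => /andP[/eqP-> _].
  by apply: mon_ideal_all; rewrite /lower /= lepm_refl orbT.
have /existsP[x bx] : [exists x, (0 < b x)%N].
  apply: contraNT b0; rewrite negb_exists => /forallP b0.
  by apply/eqP/mnmP => i; rewrite mnm0E; have := b0 i; rewrite lt0n negbK => /eqP.
have xU : x \in U := BU b bB x bx.
have xX : x \notin X by apply: contraTN xU => xX; rewrite (disjointFl dUX).
have leUx : (#|U :\ x| < n)%N by move: leUn; rewrite (cardsD1 x) xU.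
set B0 := [seq b : 'X_{1..s} <- B | b x == 0%N].
set B1 := [seq (b - U_(x))%MM | b : 'X_{1..s} <- B].
have B0B e : lower X B0 e -> lower X B e.
  case/orP=> [Xe|/hasP[b']]; first by rewrite /lower Xe.
  rewrite mem_filter => /andP[_ b'B] b'e.
  by apply/orP; right; apply/hasP; exists b'.
have B0U : supported (U :\ x) B0.
  move=> b'; rewrite mem_filter => /andP[/eqP b'x b'B] i b'i; rewrite in_setD1.
  by rewrite (BU b') // andbT; apply: contraTneq b'i => ->; rewrite b'x.
have dUxX : [disjoint U :\ x & X].
  by apply: disjointWl dUX; rewrite subD1set.
have leUxX : (#|U :\ x| + #|X| <= c)%N.
  by apply: leq_trans leUXc; rewrite leq_add2r subset_leq_card // subD1set.
have L0f : mon_ideal u (lower (x |: X) B0) f.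
  have LB0 e : lower X B e -> lower (x |: X) B0 e.
    case/orP=> [/exists_inP[y yX ey]|/hasP[b' b'B b'e]].
      by apply/orP; left; apply/exists_inP; exists y => //; rewrite in_setU1 yX orbT.
    have [b'x|b'x] := posnP (b' x).
      apply/orP; right; apply/hasP; exists b' => //.
      by rewrite mem_filter b'x eqxx.
    apply/orP; left; apply/exists_inP; exists x; first by rewrite in_setU1 eqxx.
    exact: leq_trans b'x (mnm_lepP b'e x).
  move/(mon_ideal_mono LB0): Ljf; apply: (IHn _ (U :\ x)) => //.
  - rewrite disjoint_sym disjoints_subset subUset sub1set !inE eqxx /=.
    by rewrite -disjoints_subset disjoint_sym.
  - by move: leUXc; rewrite cardsU1 xX (cardsD1 x U) xU !add1n addSnnS.
  - by rewrite in_setD1 negb_and jU orbT.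
  - rewrite in_setU1 negb_or jX andbT; apply: contraNneq jU => ->; exact: xU.
have split0 e : lower (x |: X) B0 e ->
    lower X B0 e \/ (U_(x) <= e)%MM /\ predT (e - U_(x))%MM.
  case/orP=> [/exists_inP[y]|B0e]; last by left; rewrite /lower B0e orbT.
  rewrite in_setU1 => /orP[/eqP->|yX] ey; first by right; rewrite lemU ey.
  by left; apply/orP; left; apply/exists_inP; exists y.
have [g [h [fE L0g _]]] := mon_ideal_split split0 L0f.
rewrite {}fE monU in Ljf *.
have Lg : mon_ideal u (lower X B) g := mon_ideal_mono B0B L0g.
have [_ LD LM] := mon_ideal_is_ideal u (lower X B); apply: LD => //.
have L1h : mon_ideal u (lower X B1) h.
  apply: IHk => //.
  - rewrite /B1 big_map (big_rem b) //=; move: leBk; rewrite (big_rem b) //=.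
    apply: leq_trans; rewrite -addSn leq_add //.
      rewrite -{2}(@submK _ U_(x)%MM b) ?lemU //.
      by rewrite mdegD mdeg1 addn1.
    by apply: leq_sum => b' _; apply: mdegB.
  - move=> _ /mapP[b' b'B ->] i; rewrite mnmBE => b'i; apply: (BU b') => //.
    exact: leq_trans b'i (leq_subr _ _).
  have Lxjh : mon_ideal u (lower X B) (u x * (u j * h)).
    apply: (ideal_add_cancel _ (f := u j * g)) => //; last exact: LM.
    by rewrite (_ : _ + _ = u j * (g + u x * h)) //; ring.
  apply: mon_ideal_colon_gen Lxjh; first exact: lower_split.
    exact: lower_filter_sub.
  move=> g'; apply: (IHn _ (U :\ x)) => //.
  by rewrite in_setD1 eqxx.
apply: mon_idealU L1h => e /orP[/exists_inP[y yX ey]|/hasP[_ /mapP[b' b'B ->] b'e]].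
  apply/orP; left; apply/exists_inP; exists y => //; rewrite mnmDE.
  exact: leq_trans ey (leq_addr _ _).
apply/orP; right; apply/hasP; exists b' => //; apply/mnm_lepP => i.
by have := mnm_lepP b'e i; rewrite mnmBE mnmDE leq_subLR addnC.
Qed.

Lemma mon_ideal_colonU U L x f :
    (#|U| <= c)%N -> upper_on U L ->
  mon_ideal u L (u x * f) -> mon_ideal u (fun e => L (e + U_(x))%MM) f.
Proof.
move=> leUc upL /(mon_ideal_finite upL)[B [BL BU Bf]].
set B1 := [seq (b - U_(x))%MM | b : 'X_{1..s} <- B].
have lower0 B' e : has (fun b => (b <= e)%MM) B' = lower set0 B' e.
  rewrite /lower; case: exists_inP => // -[y]; by rewrite inE.
have {}Bf : mon_ideal u (lower set0 B) (u x * f).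
  by apply: mon_ideal_mono Bf => e; rewrite lower0.
have leUx : (#|U :\ x| <= #|U|)%N by rewrite subset_leq_card // subD1set.
suff : mon_ideal u (lower set0 B1) f.
  apply: mon_ideal_mono => e; rewrite -lower0 has_map => /hasP[b /BL Lb be].
  apply: upL Lb => i _.
  by have := mnm_lepP be i; rewrite /= mnmBE mnmDE leq_subLR addnC.
apply: mon_ideal_colon_gen Bf; first exact: lower_split.
  exact: lower_filter_sub.
move=> g; apply: (@lower_regular _ (U :\ x)); rewrite ?inE ?eqxx //.
- by rewrite disjoint_sym disjoints_subset sub0set.
- by rewrite cards0 addn0; apply: leq_trans leUx leUc.
move=> b; rewrite mem_filter => /andP[/eqP bx bB] i bi.
by rewrite in_setD1 (BU b) // andbT; apply: contraTneq bi => ->; rewrite bx.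
Qed.

Lemma upper_on_shift U L a : upper_on U L -> upper_on U (fun e => L (e + a)%MM).
Proof.
by move=> upL e e' ee'; apply: upL => i /ee'; rewrite !mnmDE leq_add2r.
Qed.

Lemma mon_ideal_colon U L a f :
    (#|U| <= c)%N -> upper_on U L ->
  mon_ideal u L (mon u a * f) -> mon_ideal u (fun e => L (e + a)%MM) f.
Proof.
move=> leUc; have [n] := ubnP (mdeg a); elim: n => // n IHn in a L f *.
rewrite ltnS => lean upL Laf.
have [/existsP[x ax]|a0] := boolP [exists x, (0 < a x)%N]; last first.
  have -> : a = 0%MM.
    apply/mnmP => i; rewrite mnm0E; apply/eqP; rewrite -leqn0 leqNgt.
    by move: a0; rewrite negb_exists => /forallP.
  have -> : f = mon u a * f.
    rewrite /mon big1 ?mul1r // => i _.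
    move: a0; rewrite negb_exists => /forallP/(_ i).
    by rewrite lt0n negbK => /eqP->.
  by apply: mon_ideal_mono Laf => e; rewrite addm0.
have aE : (a = (a - U_(x)) + U_(x))%MM by rewrite submK ?lemU.
have {Laf} : mon_ideal u L (u x * (mon u (a - U_(x))%MM * f)).
  by move: Laf; rewrite {1}aE monD monU mulrA [u x * _]mulrC.
move/(mon_ideal_colonU leUc upL)/IHn.
rewrite -ltnS (leq_trans _ (lean : (_ < n.+1)%N)) //; last first.
  by rewrite {2}aE mdegD mdeg1 addn1.
move=> /(_ isT (upper_on_shift upL)); apply: mon_ideal_mono => e.
by rewrite {2}aE addmA.
Qed.

(** After division by [u^a], no exponent vector in the set is zero on [U],
    because [a] itself is not in [L]. *)
Lemma mon_ideal_coef U L a r :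
    (#|U| <= c)%N -> upper_on U L -> ~~ L a ->
  mon_ideal u L (mon u a * r) -> vars_ideal u U r.
Proof.
move=> leUc upL La /(mon_ideal_colon leUc upL).
apply: mon_ideal_mono => e; apply: contraTT; rewrite negb_exists_in => /forall_inP e0.
apply: contra La; apply: upL => i /e0; rewrite mnmDE lt0n negbK => /eqP->.
by rewrite add0n.
Qed.

End RegularFamily.

(** * Intersections of powers of the ideals generated by [c] members *)

Section StarConfiguration.

Variables (R : comNzRingType) (s : nat) (u : 'I_s -> R) (c : nat).
Implicit Types (e a b w : 'X_{1..s}) (f g h r : R) (S U X : {set 'I_s}).

Definition part_deg S e := (\sum_(i in S) e i)%N.

Definition star_exponents m : pred 'X_{1..s} :=
  fun e => [forall S : {set 'I_s}, (#|S| == c) ==> (m <= part_deg S e)%N].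

Lemma part_degD S a e : part_deg S (a + e)%MM = (part_deg S a + part_deg S e)%N.
Proof. by rewrite /part_deg -big_split; apply: eq_bigr => i _; rewrite mnmDE. Qed.

Lemma part_deg_ge S i e : i \in S -> (e i <= part_deg S e)%N.
Proof. by move=> iS; rewrite /part_deg (bigD1 i) //= leq_addr. Qed.

Lemma leq_part_deg S a e :
  (forall i, i \in S -> (a i <= e i)%N) -> (part_deg S a <= part_deg S e)%N.
Proof. by move=> ae; apply: leq_sum. Qed.

Lemma part_degD1 S i e : i \in S -> part_deg S e = (e i + part_deg (S :\ i) e)%N.
Proof.
move=> iS; rewrite /part_deg (bigD1 i) //=; congr (_ + _)%N.
by apply: eq_bigl => j; rewrite in_setD1 andbC.
Qed.

Lemma part_deg_mnm1 S i : i \in S -> part_deg S U_(i)%MM = 1%N.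
Proof.
move=> iS; rewrite /part_deg (bigD1 i) //= mnm1E eqxx big1 // => j /andP[_ /negbTE ji].
by rewrite mnm1E eq_sym ji.
Qed.

Lemma part_deg_upper S m : upper_on S (fun e => m <= part_deg S e)%N.
Proof. by move=> e e' ee' /leq_trans; apply; apply: leq_part_deg. Qed.

Lemma part_degU S m e : (0 < m)%N -> (m <= part_deg S e)%N ->
  exists2 i, i \in S & (0 < e i)%N.
Proof.
move=> m0 mS; suff /exists_inP[i] : [exists i in S, 0 < e i]%N by exists i.
apply: contraLR mS; rewrite negb_exists_in => /forall_inP e0.
rewrite -ltnNge /part_deg big1 // => i /e0.
by rewrite lt0n negbK => /eqP.
Qed.

Hypothesis u_reg : regular_family u c.

(* The weight [w] records the variables already divided out, [X] those that
   are set to zero; the conditions then concern the sets of [c - #|X|]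
   variables outside [X]. *)
Let meets X e := [exists x in X, 0 < e x]%N.
Let slice X S := [disjoint S & X] && (#|S| + #|X| == c)%N.
Let heavy X w m e :=
  [forall S : {set 'I_s}, slice X S ==> (m <= part_deg S (e + w)%MM)%N].

Let meets_upper X : upper_on X (meets X).
Proof.
move=> e e' ee' /exists_inP[x xX ex]; apply/exists_inP; exists x => //.
exact: leq_trans ex (ee' x xX).
Qed.

(** The variable [x] to peel off is one of least weight: if a [c]-set [S] does
    not contain [x], exchanging any of its members for [x] does not increase
    the degree modulo [u x]. So the conditions on the sets through [x] imply
    all the others there, and [f = g + u x * h] with [g] in the ideal. The
    remainder [h] satisfies the hypotheses with the weight of [x] raised. *)
Lemma star_intersection_weighted X w m f :
    (#|X| <= c)%N ->
    (forall S, slice X S ->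
       mon_ideal u (fun e => meets X e || (m <= part_deg S (e + w)%MM)%N) f) ->
  mon_ideal u (fun e => meets X e || heavy X w m e) f.
Proof.
have [d] := ubnP (c - #|X|)%N; elim: d => // d IHd in X w m f *; rewrite ltnS.
have [k] := ubnP (\sum_(i | i \notin X) (m - w i))%N.
elim: k => // k IHk in w f *; rewrite ltnS => lek led leXc Sf.
have [ltXc|] := ltnP #|X| c; last first.
  move=> lecX; have {leXc lecX} cX : #|X| = c by apply/eqP; rewrite eqn_leq leXc.
  have sl0 : slice X set0.
    by rewrite /slice disjoints_subset sub0set cards0 add0n cX eqxx.
  apply: mon_ideal_mono (Sf _ sl0) => e /orP[->//|m0].
  apply/orP; right; apply/forall_inP => S _.
  by apply: leq_trans m0 _; rewrite /part_deg big_set0.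
have [/exists_inP[y yX wy]|wX] := boolP [exists y in ~: X, w y < m]%N; last first.
  (* All weights outside [X] are at least [m], and [S] is not empty. *)
  apply: mon_ideal_all; apply/orP; right; apply/forall_inP => S /andP[dSX /eqP cS].
  have /card_gt0P[y yS] : (0 < #|S|)%N by lia.
  apply: leq_trans (part_deg_ge _ yS); rewrite mnmDE mnm0E add0n leqNgt.
  move: wX; rewrite negb_exists_in => /forall_inP; apply.
  by rewrite in_setC (disjointFr dSX).
have [x xX xmin] : exists2 x, x \notin X & forall i, i \notin X -> (w x <= w i)%N.
  have := @arg_minnP _ y [pred i | i \notin X] w; rewrite /= -in_setC => /(_ yX).
  by case=> x xX xmin; exists x.
have wx : (w x < m)%N by apply: leq_ltn_trans wy; apply: xmin; rewrite -in_setC.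
have sliceD S : slice X S -> x \in S -> slice (x |: X) (S :\ x).
  case/andP=> dSX /eqP cS xS; apply/andP; split.
    rewrite disjoint_sym disjoints_subset subUset sub1set !inE eqxx /=.
    rewrite -disjoints_subset disjoint_sym; apply: disjointWl dSX.
    exact: subD1set.
  by rewrite cardsU1 xX /= -cS (cardsD1 x S) xS !add1n addSnnS.
have heavyD e : meets (x |: X) e || heavy (x |: X) w (m - w x) e ->
    (meets X e || heavy X w m e) \/ (U_(x) <= e)%MM /\ predT (e - U_(x))%MM.
  case/orP=> [/exists_inP[y' ]|/forall_inP hv].
    rewrite in_setU1 => /orP[/eqP->|y'X] ey; first by right; rewrite lemU ey.
    by left; apply/orP; left; apply/exists_inP; exists y'.
  left; apply/orP; right; apply/forall_inP => S slS.
  have [i iS leSi] : exists2 i, i \in S & slice (x |: X) (S :\ i).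
    have [xS|xS] := boolP (x \in S); first by exists x => //; apply: sliceD.
    have /andP[dSX /eqP cS] := slS.
    have /card_gt0P[i iS] : (0 < #|S|)%N by lia.
    exists i => //; apply/andP; split.
      rewrite disjoint_sym disjoints_subset subUset sub1set !inE (negbTE xS) andbF /=.
      rewrite -disjoints_subset disjoint_sym; apply: disjointWl dSX.
      exact: subD1set.
    by rewrite cardsU1 xX /= -cS (cardsD1 i S) iS !add1n addSnnS.
  have := hv _ leSi; rewrite leq_subLR => /leq_trans; apply.
  rewrite (part_degD1 _ iS) leq_add2r mnmDE.
  have /andP[dSX _] := slS.
  by apply: leq_trans (leq_addl _ _); apply: xmin; rewrite (disjointFr dSX).
have : mon_ideal u (fun e => meets (x |: X) e || heavy (x |: X) w (m - w x) e) f.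
  apply: IHd.
  - have -> : #|x |: X| = #|X|.+1 by rewrite cardsU1 xX.
    lia.
  - by rewrite cardsU1 xX /= add1n.
  move=> S /andP[dSX /eqP cS].
  have xS : x \notin S.
    by apply/negP => xS; move: (disjointFr dSX xS); rewrite in_setU1 eqxx.
  have sl : slice X (x |: S).
    apply/andP; split.
      rewrite disjoints_subset subUset sub1set in_setC xX -disjoints_subset.
      by apply: disjointWr dSX; apply: subsetUr.
    by rewrite -cS !cardsU1 xX xS !add1n addSnnS.
  apply: mon_ideal_mono (Sf _ sl) => e /orP[/exists_inP[y' y'X ey]|].
    by apply/orP; left; apply/exists_inP; exists y' => //; rewrite in_setU1 y'X orbT.
  have [ex|ex] := posnP (e x); last first.
    by move=> _; apply/orP; left; apply/exists_inP; exists x => //; rewrite in_setU1 eqxx.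
  rewrite (part_degD1 (i := x)) ?in_setU1 ?eqxx // mnmDE ex add0n setU1K // => le.
  by apply/orP; right; rewrite leq_subLR.
case/(mon_ideal_split heavyD) => g [h [fE Lg _]]; rewrite {}fE monU in Sf *.
have [_ LD _] := mon_ideal_is_ideal u (fun e => meets X e || heavy X w m e).
apply: LD => //.
have {IHk} : mon_ideal u (fun e => meets X e || heavy X (w + U_(x))%MM m e) h.
  apply: IHk => //.
    apply: leq_trans lek; rewrite (bigD1 x) //= [in X in (_ < X)%N](bigD1 x) //=.
    rewrite -addSn leq_add //; first by rewrite mnmDE mnm1E eqxx; lia.
    by apply: leq_sum => i _; rewrite leq_sub2l // mnmDE leq_addr.
  move=> S slS.
  have Lx : mon_ideal u (fun e => meets X e || (m <= part_deg S (e + w)%MM)%N) (u x * h).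
    apply: (ideal_add_cancel _ (f := g)) => //; first exact: Sf.
    apply: mon_ideal_mono Lg => e /orP[->//|/forall_inP/(_ S slS)->].
    by rewrite orbT.
  have /andP[_ /eqP cS] := slS.
  have leSX : (#|S :|: X| <= c)%N by rewrite -cS cardsU leq_subr.
  have upSX : upper_on (S :|: X) (fun e => meets X e || (m <= part_deg S (e + w)%MM)%N).
    move=> e e' ee' /orP[mX|mS]; apply/orP; [left|right].
      by apply: meets_upper mX => i iX; apply: ee'; rewrite inE iX orbT.
    apply: leq_trans mS _; apply: leq_part_deg => i iS.
    by rewrite !mnmDE leq_add2r ee' // inE iS.
  move/(mon_ideal_colonU u_reg leSX upSX): Lx.
  apply: mon_ideal_mono => e; rewrite -addmA (addmC U_(x)%MM).
  case/orP=> [/exists_inP[y' y'X]|->]; last by rewrite orbT.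
  rewrite mnmDE mnm1E; have [xy'|_] := eqVneq x y'; last first.
    by rewrite addn0 => ey; apply/orP; left; apply/exists_inP; exists y'.
  by move: xX; rewrite xy' y'X.
apply: mon_idealU => e /orP[/exists_inP[y' y'X ey]|/forall_inP hv].
  apply/orP; left; apply/exists_inP; exists y' => //; rewrite mnmDE.
  exact: leq_trans ey (leq_addr _ _).
apply/orP; right; apply/forall_inP => S /hv.
by rewrite -addmA (addmC U_(x)%MM).
Qed.

Lemma star_intersection m f :
    (forall S, #|S| = c -> mon_ideal u (fun e => m <= part_deg S e)%N f) ->
  mon_ideal u (star_exponents m) f.
Proof.
move=> Sf.
have meets0 e : meets set0 e = false.
  by apply/exists_inP => -[x]; rewrite inE.
have slice0 S : slice set0 S = (#|S| == c).
  by rewrite /slice disjoint_sym disjoints_subset sub0set cards0 addn0.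
have : mon_ideal u (fun e => meets set0 e || heavy set0 0%MM m e) f.
  apply: star_intersection_weighted; first by rewrite cards0.
  move=> S; rewrite slice0 => /eqP/Sf; apply: mon_ideal_mono => e.
  by rewrite meets0 addm0.
apply: mon_ideal_mono => e; rewrite meets0 => /forall_inP hv.
by apply/forall_inP => S cS; rewrite -[e]addm0; apply: hv; rewrite slice0.
Qed.

End StarConfiguration.

(** * Noetherianity of polynomial rings *)

(** The next index is one where [f] is least on the rest of the sequence. *)
Lemma nondecreasing_subsequence (f : nat -> nat) :
  exists phi : nat -> nat, (forall i j, (i < j)%N -> (phi i < phi j)%N) /\
    forall i j, (i <= j)%N -> (f (phi i) <= f (phi j))%N.
Proof.
have next k : exists j, (k < j)%N /\ forall i, (k < i)%N -> (f j <= f i)%N.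
  suff least v j : (k < j)%N -> (f j < v)%N ->
      exists j, (k < j)%N /\ forall i, (k < i)%N -> (f j <= f i)%N.
    exact: (least (f k.+1).+1 k.+1).
  elim: v j => // v IHv j kj; rewrite ltnS => fjv.
  have [[i [ki fij]]|nmin] := classic (exists i, (k < i)%N /\ (f i < f j)%N).
    by apply: (IHv i ki); apply: leq_trans fij fjv.
  exists j; split=> // i ki; rewrite leqNgt; apply/negP => fij.
  by apply: nmin; exists i.
pose nxt k := proj1_sig (constructive_indefinite_description _ (next k)).
have nxtP k : (k < nxt k)%N /\ forall i, (k < i)%N -> (f (nxt k) <= f i)%N.
  exact: (proj2_sig (constructive_indefinite_description _ (next k))).
pose phi i := iter i.+1 nxt 0%N.
have phiS i : (phi i < phi i.+1)%N by case: (nxtP (phi i)).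
have phi_lt i j : (i < j)%N -> (phi i < phi j)%N.
  exact: (homo_ltn (@ltn_trans) phiS).
exists phi; split; first exact: phi_lt.
move=> i j; rewrite [(i <= j)%N]leq_eqVlt => /orP[/eqP->|ij]; first exact: leqnn.
case: (nxtP (iter i nxt 0%N)) => _; apply.
by apply: ltn_trans (phi_lt _ _ ij); case: (nxtP (iter i nxt 0%N)).
Qed.

(** Dickson's lemma. *)
Lemma dickson n (sigma : nat -> 'X_{1..n}) :
  exists i j, (i < j)%N /\ (sigma i <= sigma j)%MM.
Proof.
suff [phi [phi_lt phiM]] : exists phi : nat -> nat,
    (forall i j, (i < j)%N -> (phi i < phi j)%N) /\
    forall x, x \in enum 'I_n ->
      forall i j, (i <= j)%N -> (sigma (phi i) x <= sigma (phi j) x)%N.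
  exists (phi 0%N), (phi 1%N); split; first exact: phi_lt.
  by apply/mnm_lepP => x; apply: phiM => //; rewrite mem_enum.
elim: (enum 'I_n) => [|x r [phi [phi_lt phiM]]]; first by exists id.
have [psi [psi_lt psiM]] := nondecreasing_subsequence (fun k => sigma (phi k) x).
have psi_le i j : (i <= j)%N -> (psi i <= psi j)%N.
  by rewrite [(i <= j)%N]leq_eqVlt => /orP[/eqP->|/psi_lt/ltnW].
exists (phi \o psi); split=> [i j ij|y]; first by apply/phi_lt/psi_lt.
rewrite inE => /orP[/eqP->|yr] i j ij; first exact: psiM.
by apply: phiM yr _ _ (psi_le _ _ ij).
Qed.

(** ** Maximal ideals in a family *)

Section Noetherian.

Variables (k : fieldType) (n : nat).
Notation R := {mpoly k[n]}.

Lemma mlead_sub_lt (f g : R) (c := f@_(mlead f) / g@_(mlead g)) :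
    g != 0 -> (mlead g <= mlead f)%MM ->
    f - c *: ('X_[mlead f - mlead g] * g) != 0 ->
  (mlead (f - c *: ('X_[mlead f - mlead g] * g)) < mlead f)%O.
Proof.
move=> g0 le_gf; set q := 'X_[_] * g; set h := f - _ => h0.
have lq : mlead q = mlead f.
  by rewrite /q mleadM ?mleadXm ?submK // -msize_poly_eq0 msizeX.
have cq : q@_(mlead f) = g@_(mlead g).
  by rewrite /q mulrC -(mcoeffMX g (mlead f - mlead g)%MM (mlead g)) submK.
have hf : h@_(mlead f) = 0.
  by rewrite /h mcoeffB mcoeffZ cq /c divfK ?subrr // mleadc_eq0.
rewrite lt_neqAle; apply/andP; split.
  by apply: contraNneq h0 => hE; rewrite -mleadc_eq0 hE hf.
apply: le_trans (mleadB_le _ _) _.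
rewrite leUx lexx /= -lq.
exact: mleadZ_le.
Qed.

(** A chain without maximal element would be strictly increasing; in each
    step take a new polynomial of least leading monomial. Two of these
    monomials divide one another, and the later polynomial can be reduced by
    the earlier one. *)
Lemma ideal_maximal (T : Type) (D : T -> Prop) (J : T -> R -> Prop) t0 :
    (forall t, D t -> is_ideal (J t)) -> D t0 ->
  exists t, [/\ D t, forall f, J t0 f -> J t f &
    forall t', D t' -> (forall f, J t f -> J t' f) -> forall f, J t' f -> J t f].
Proof.
move=> idJ Dt0; apply: NNPP => nomax.
pose E t := D t /\ forall f, J t0 f -> J t f.
have step (t : {t | E t}) : exists t' : {t | E t},
    (forall f, J (sval t) f -> J (sval t') f) /\
    exists f, [/\ J (sval t') f, ~ J (sval t) f &
      forall g, J (sval t') g -> ~ J (sval t) g -> (mlead f <= mlead g)%O].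
  case: t => t [Dt Jt0] /=.
  have [t' [Dt' Jtt' [f0 J'f0 Jf0]]] : exists t', [/\ D t',
      forall f, J t f -> J t' f & exists2 f, J t' f & ~ J t f].
    apply: NNPP => H; apply: nomax; exists t; split=> // t' Dt' Jtt' f J'f.
    by apply: NNPP => Jf; apply: H; exists t'; split=> //; exists f.
  have Et' : E t' by split=> // f /Jt0/Jtt'.
  exists (exist _ t' Et'); split=> //=.
  elim/(ltmwf (n := n)): (mlead f0) {-2}f0 (erefl (mlead f0)) J'f0 Jf0 => m IHm f fm J'f Jf.
  have [[g [J'g Jg gf]]|minf] :=
      classic (exists g, [/\ J t' g, ~ J t g & (mlead g < mlead f)%O]).
    by apply: (IHm (mlead g) _ g) => //; rewrite -fm.
  exists f; split=> // g J'g Jg; rewrite leNgt; apply/negP => gf.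
  by apply: minf; exists g.
pose nxt t := proj1_sig (constructive_indefinite_description _ (step t)).
have nxtP t := proj2_sig (constructive_indefinite_description _ (step t)).
pose tau i := iter i nxt (exist E t0 (conj Dt0 (fun f => id))).
pose K i := J (sval (tau i)).
have KS i : forall f, K i f -> K i.+1 f by case: (nxtP (tau i)).
have Kle i j : (i <= j)%N -> forall f, K i f -> K j f.
  move=> ij f Kf; rewrite -(subnKC ij); elim: (j - i)%N => [|d Kd].
    by rewrite addn0.
  by rewrite addnS; apply: KS.
have idK i : is_ideal (K i) by apply: idJ; case: (proj2_sig (tau i)).
have newf i : exists f, [/\ K i.+1 f, ~ K i f &
    forall g, K i.+1 g -> ~ K i g -> (mlead f <= mlead g)%O].
  by case: (nxtP (tau i)).
pose phi i := proj1_sig (constructive_indefinite_description _ (newf i)).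
have phiP i : [/\ K i.+1 (phi i), ~ K i (phi i) &
    forall g, K i.+1 g -> ~ K i g -> (mlead (phi i) <= mlead g)%O].
  exact: (proj2_sig (constructive_indefinite_description _ (newf i))).
have [i [j [ij le_ij]]] := dickson (fun i => mlead (phi i)).
have [Ki nKi _] := phiP i; have [Kj nKj minj] := phiP j.
have i0 : phi i != 0 by apply: contra_notN nKi => /eqP->; case: (idK i).
set c := (phi j)@_(mlead (phi j)) / (phi i)@_(mlead (phi i)).
set q := c *: ('X_[mlead (phi j) - mlead (phi i)] * phi i).
have Kjq : K j q.
  have [_ _ KM] := idK j; rewrite /q -mul_mpolyC mulrA; apply: KM.
  exact: Kle ij _ Ki.
have nKjq : ~ K j (phi j - q).
  move=> Kq; apply: nKj; rewrite -(subrK q (phi j)).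
  by case: (idK j) => _ KD _; apply: KD.
have := minj (phi j - q); rewrite leNgt mlead_sub_lt //; last first.
  by apply: contra_notN nKjq => /eqP->; case: (idK j).
move=> H; have : false by apply: H => //; apply: ideal_subr => //; apply: KS.
by [].
Qed.

(** A maximal annihilator of an element outside [J], modulo [J], is prime. *)
Lemma exists_associated_prime (J : R -> Prop) r :
    is_ideal J -> ~ J r ->
  exists2 P : R -> Prop, associated_prime J P & forall f, J (f * r) -> P f.
Proof.
move=> idJ Jr.
have [g [Jg rg gmax]] := ideal_maximal (D := fun g => ~ J g)
  (J := fun g f => J (f * g)) (fun g _ => colon_is_ideal g idJ) Jr.
have [J0 JD JM] := idJ.
exists (fun f => J (f * g)); last exact: rg.
split; last by exists g.
split; [exact: colon_is_ideal|by rewrite mul1r|].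
move=> x y Jxy; have [Jx|Jx] := classic (J (x * g)); first by left.
right; apply: (gmax (x * g)) => //.
  by move=> f Jf; rewrite mulrCA; apply: JM.
by rewrite mulrA (mulrC y).
Qed.

End Noetherian.

(** * Symbolic powers *)

Lemma prime_ideal_prod (R : comNzRingType) (P : R -> Prop) (T : finType)
    (A : pred T) (E : T -> R) :
  prime_ideal P -> (forall i, A i -> ~ P (E i)) -> ~ P (\prod_(i | A i) E i).
Proof.
case=> _ P1 PM EP; apply: (big_ind (fun x => ~ P x)) => // x y Px Py.
by case/PM.
Qed.

Lemma prime_ideal_exp (R : comNzRingType) (P : R -> Prop) f m :
  prime_ideal P -> ~ P f -> ~ P (f ^+ m).
Proof.
case=> _ P1 PM Pf; elim: m => [|m Pm]; first by rewrite expr0.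
by rewrite exprS => /PM[].
Qed.

Lemma extended_idealP (R : idomainType) (P J : R -> Prop) f :
    prime_ideal P -> is_ideal J ->
  extended_ideal P J (tofrac f) <-> exists b, ~ P b /\ J (b * f).
Proof.
move=> [[P0 _ _] P1 PM] [J0 JD JM].
have den_neq0 b : ~ P b -> tofrac b != 0.
  by move=> Pb; rewrite tofrac_eq0; apply: contra_notN Pb => /eqP->.
split=> [[l [lP fE]]|[b [Pb Jbf]]]; last first.
  exists [:: ((tofrac 1 / tofrac b), b * f)]; split.
    by move=> p; rewrite inE => /eqP-> /=; split=> //; exists 1, b.
  by rewrite big_seq1 tofracM tofrac1 mul1r mulKf // den_neq0.
suff [b [g [Pb Jg bg]]] : exists b g,
    [/\ ~ P b, J g & tofrac b * \sum_(p <- l) p.1 * tofrac p.2 = tofrac g].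
  exists b; split=> //; suff -> : b * f = g by [].
  by apply/eqP; rewrite -tofrac_eq tofracM fE bg.
elim: l lP {f fE} => [|p l IHl] lP.
  by exists 1, 0; split=> //; rewrite big_nil mulr0 tofrac0.
have [|b [g [Pb Jg bg]]] := IHl; first by move=> q ql; apply: lP; rewrite inE ql orbT.
have [[a [d [Pd pE]]] Jp] := lP p (mem_head _ _).
exists (b * d), (b * a * p.2 + d * g); split; first by case/PM.
  by apply: JD; apply: JM.
rewrite big_cons pE tofracD !tofracM -bg mulrDr; congr (_ + _); last by ring.
by have := den_neq0 d Pd; move=> ?; field.
Qed.

Lemma ideal_powS (R : comNzRingType) (I : R -> Prop) m a f :
  I a -> ideal_pow I m f -> ideal_pow I m.+1 (a * f).
Proof.
move=> Ia; rewrite mulrC; move: f; apply: ideal_gen_least.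
  by apply: colon_is_ideal; apply: ideal_gen_is_ideal.
move=> _ [v [Iv ->]]; apply: ideal_gen_base.
exists (fun i => if unlift ord0 i is Some j then v j else a); split.
  by move=> i; case: unliftP.
rewrite big_ord_recl unlift_none mulrC; congr (_ * _).
by apply: eq_bigr => i _; rewrite liftK.
Qed.

Lemma ideal_pow0 (R : comNzRingType) (I : R -> Prop) f : ideal_pow I 0 f.
Proof.
rewrite -[f]mulr1; case: (ideal_gen_is_ideal
  (fun f => exists v : 'I_0 -> R, (forall i, I (v i)) /\ f = \prod_(i < 0) v i)).
move=> _ _; apply; apply: ideal_gen_base.
by exists (fun=> 0); split; [case|rewrite big_ord0].
Qed.

Section SymbolicPowers.

Variables (R : idomainType) (s : nat) (u : 'I_s -> R) (c : nat).
Implicit Types (e a b : 'X_{1..s}) (f g r : R) (S T : {set 'I_s}) (P : R -> Prop).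

(** The ordinary power [(u_i : i in S)^m], generated by its monomials. *)
Definition vars_pow S m : R -> Prop := mon_ideal u (fun e => m <= part_deg S e)%N.

Let I := codim_ideal c u.

Lemma codim_idealP f : I f <-> forall S, #|S| = c -> vars_ideal u S f.
Proof. by split=> If S /If /vars_idealP. Qed.

Lemma vars_pow_sub S m i f : (i <= m)%N -> vars_pow S m f -> vars_pow S i f.
Proof. by move=> im; apply: mon_ideal_mono => e; apply: leq_trans. Qed.

Lemma vars_pow0 S f : vars_pow S 0 f.
Proof. exact: mon_ideal_all. Qed.

Lemma vars_ideal_mem S i f : i \in S -> vars_ideal u S (u i * f).
Proof.
move=> iS; apply: ideal_mulr; first exact: mon_ideal_is_ideal.
by apply/vars_idealP; apply: ideal_gen_base; exists i.
Qed.

Lemma vars_idealM S m f g :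
  vars_ideal u S f -> vars_pow S m g -> vars_pow S m.+1 (f * g).
Proof.
apply: mon_idealM => a e /exists_inP[i iS ai] me; rewrite part_degD -add1n.
by rewrite leq_add // (leq_trans ai) // part_deg_ge.
Qed.

Lemma ideal_pow_vars_pow S m f : #|S| = c -> ideal_pow I m f -> vars_pow S m f.
Proof.
move=> cS; move: f; apply: ideal_gen_least; first exact: mon_ideal_is_ideal.
move=> _ [v [Iv ->]]; elim: m v Iv => [|m IHm] v Iv; first exact: vars_pow0.
rewrite big_ord_recl; apply: vars_idealM; last exact: IHm.
by have /codim_idealP/(_ S cS) := Iv ord0.
Qed.

(** It multiplies [(u_i : i in S)] into the intersection [I], and it is outside
    the primes associated to [(u_i : i in S)]: locally at these primes the two
    ideals agree. *)
Definition cofactor S : R := \prod_(j | j \notin S) u j.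

Lemma cofactor_other S T f : #|S| = c -> #|T| = c -> T != S ->
  vars_ideal u T (cofactor S * f).
Proof.
move=> cS cT TS; have /subsetPn[j jT jS] : ~~ (T \subset S).
  by apply: contra TS => TS; rewrite eqEcard TS cS cT leqnn.
by rewrite /cofactor (bigD1 j) //= -mulrA; apply: vars_ideal_mem.
Qed.

Lemma cofactor_codim S f : #|S| = c -> vars_ideal u S f -> I (cofactor S * f).
Proof.
move=> cS Sf; apply/codim_idealP => T cT.
have [->|TS] := eqVneq T S; last exact: cofactor_other.
by case: (mon_ideal_is_ideal u (fun e => [exists x in S, 0 < e x]%N)) => _ _; apply.
Qed.

Lemma vars_pow_cofactor S m f :
  #|S| = c -> vars_pow S m f -> ideal_pow I m (cofactor S ^+ m * f).
Proof.
move=> cS; rewrite mulrC; move: f; apply: mon_ideal_least.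
  by apply: colon_is_ideal; apply: ideal_gen_is_ideal.
elim: m => [|m IHm] e me; first exact: ideal_pow0.
have [i iS ei] := part_degU (ltn0Sn _) me; have lei : (U_(i) <= e)%MM by rewrite lemU.
rewrite (mon_split u lei) monU exprS.
have -> : mon u (e - U_(i))%MM * u i * (cofactor S * cofactor S ^+ m) =
    (cofactor S * u i) * (mon u (e - U_(i))%MM * cofactor S ^+ m) by ring.
apply: ideal_powS; last first.
  apply: IHm; move: me; rewrite -{1}(submK lei) part_degD.
  by rewrite part_deg_mnm1 // addn1.
by apply: cofactor_codim => //; rewrite -[u i]mulr1; apply: vars_ideal_mem.
Qed.

Hypothesis u_reg : regular_family u c.

Lemma colon_vars_prime S g P j :
    #|S| = c -> prime_ideal P -> (forall f, P f -> vars_ideal u S (f * g)) ->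
  ~ vars_ideal u S g -> j \notin S -> ~ P (u j).
Proof.
move=> cS pP PE Sg jS /PE; move/(u_reg _ jS); rewrite cS => /(_ (leqnn _)).
exact: Sg.
Qed.

(** If [P] is the annihilator of [g] modulo [I], choose [S] with [g] outside
    [(u_i : i in S)]. The members outside [S] are regular modulo that ideal, so
    they are not in [P], and the cofactor of [S] is a unit at [P]. *)
Lemma vars_pow_symbolic m f :
  (forall S, #|S| = c -> vars_pow S m f) -> symbolic_power I m f.
Proof.
move=> Sf P [pP [g PE]]; apply/extended_idealP => //; first exact: ideal_gen_is_ideal.
have [S [cS Sg]] : exists S, #|S| = c /\ ~ vars_ideal u S g.
  apply: NNPP => nS; have [_ P1 _] := pP; apply/P1/PE; rewrite mul1r.
  by apply/codim_idealP => S cS; apply: NNPP => Sg; apply: nS; exists S.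
exists (cofactor S ^+ m); split; last exact: vars_pow_cofactor (Sf _ _).
apply: prime_ideal_exp => //; apply: prime_ideal_prod => // j.
apply: (colon_vars_prime cS pP _ Sg) => h /PE /codim_idealP; exact.
Qed.

(** In a representation of [f] by monomials of degree [i], terms whose
    coefficient lies in [(u_i : i in S)] have degree [i + 1] and can be dropped,
    so another term [r u^a] remains. Modulo the other monomials and those of
    degree [i + 1], the monomial [u^a] has no multipliers but those in
    [(u_i : i in S)]. *)
Lemma initial_coef S i f :
    (#|S| <= c)%N -> vars_pow S i f -> ~ vars_pow S i.+1 f ->
  exists r, ~ vars_ideal u S r /\
    forall g, vars_pow S i.+1 (g * f) -> vars_ideal u S (g * r).
Proof.
move=> cS Sf nSf.
have [B [BL BU Bf]] := mon_ideal_finite (@part_deg_upper _ S i) Sf.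
pose K B e := has (fun b => (b <= e)%MM) B || (i < part_deg S e)%N.
have {Sf} Kf : mon_ideal u (K B) f by apply: mon_ideal_mono Bf => e; rewrite /K => ->.
have upK B' : (forall b, b \in B' -> forall j, (0 < b j)%N -> j \in S) ->
    upper_on S (K B').
  move=> B'U e e' ee' /orP[/hasP[b bB' be]|ie]; apply/orP; [left|right].
    apply/hasP; exists b => //; apply/mnm_lepP => j.
    have [->//|bj] := posnP (b j).
    exact: leq_trans (mnm_lepP be j) (ee' j (B'U b bB' j bj)).
  exact: leq_trans ie (leq_part_deg ee').
elim: B BL BU Kf {Bf} => [|a B IHB] BL BU Kf.
  by case: nSf; apply: mon_ideal_mono Kf => e; rewrite /K.
have BL' b : b \in B -> (i <= part_deg S b)%N.
  by move=> bB; apply: BL; rewrite inE bB orbT.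
have BU' b : b \in B -> forall j, (0 < b j)%N -> j \in S.
  by move=> bB; apply: BU; rewrite inE bB orbT.
have splitK e : K (a :: B) e -> K B e \/ (a <= e)%MM /\ predT (e - a)%MM.
  case/orP=> [/orP[->|Be]|ie]; [by right|left..].
    by apply/orP; left.
  by rewrite /K ie orbT.
have [g [r [fE Kg _]]] := mon_ideal_split splitK Kf.
have [_ KD KM] := mon_ideal_is_ideal u (K B).
have [Ka|Ka] := boolP (K B a).
  apply: IHB => //; rewrite fE; apply: KD => //; rewrite mulrC; apply: KM.
  exact: mon_in_mon_ideal.
have [Sr|Sr] := classic (vars_ideal u S r).
  apply: IHB => //; rewrite fE; apply: KD => //; rewrite mulrC.
  have : vars_pow S i.+1 (r * mon u a).
    apply: vars_idealM => //; apply: mon_in_mon_ideal; apply: BL; exact: mem_head.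
  by apply: mon_ideal_mono => e; rewrite /K orbC => ->.
exists r; split=> // b Sbf; apply: (mon_ideal_coef u_reg cS (upK B BU') Ka).
apply: (ideal_add_cancel _ (f := b * g)) => //; last exact: KM.
rewrite (_ : _ + _ = b * f); last by rewrite fE; ring.
by apply: mon_ideal_mono Sbf => e; rewrite /K orbC => ->.
Qed.

(* A property of Noetherian rings. *)
Hypothesis assoc : forall (J : R -> Prop) r, is_ideal J -> ~ J r ->
  exists2 P : R -> Prop, associated_prime J P & forall f, J (f * r) -> P f.

(** If [f] has order [i < m] along [S], then a prime associated to
    [(u_i : i in S)] that contains the multipliers of an initial coefficient
    of [f] into that ideal contains every [b] with [b f] in [I ^ m]. *)
Lemma symbolic_vars_pow m f S :
  symbolic_power I m f -> #|S| = c -> vars_pow S m f.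
Proof.
move=> If cS; apply: NNPP => nSf.
have [i [im Sf nSf']] : exists i, [/\ (i < m)%N, vars_pow S i f & ~ vars_pow S i.+1 f].
  elim: m nSf {If} => [[]|m IHm nSf]; first exact: vars_pow0.
  have [Sf|/IHm[i [im Sf nSf']]] := classic (vars_pow S m f); first by exists m.
  by exists i; split=> //; apply: ltnW.
have [|r [Sr rP]] := initial_coef _ Sf nSf'; first by rewrite cS.
have [P [pP [g PE]] rPsub] := assoc (mon_ideal_is_ideal u _) Sr.
have Sg : ~ vars_ideal u S g.
  by have [_ P1 _] := pP => Sg; apply/P1/PE; rewrite mul1r.
have [_ _ PM] := pP.
have Pcof : ~ P (cofactor S).
  apply: prime_ideal_prod => // j; apply: (colon_vars_prime cS pP _ Sg) => h.
  by move/PE.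
have aP : associated_prime I P.
  split=> //; exists (cofactor S * g) => h; split=> [/PE Sh|].
    by rewrite mulrCA; apply: cofactor_codim.
  move/codim_idealP/(_ S cS); rewrite mulrA => /PE/PM[] // Ph.
have /extended_idealP[//||b [Pb Ib]] := If P aP; first exact: ideal_gen_is_ideal.
by apply/Pb/rPsub/rP; apply: vars_pow_sub im _; apply: ideal_pow_vars_pow.
Qed.

Lemma symbolic_power_star m f :
  symbolic_power I m f <-> mon_ideal u (star_exponents c m) f.
Proof.
split=> [If|].
  by apply: star_intersection => // S; apply: symbolic_vars_pow.
move=> mf; apply: vars_pow_symbolic => S cS; apply: mon_ideal_mono mf => e.
by move=> /forall_inP; apply; rewrite cS.
Qed.

End SymbolicPowers.

(** * Normal forms *)

Section NormalForms.

Variables (s c : nat).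
Implicit Types (A S T : {set 'I_s}) (L : seq {set 'I_s}) (e a b : 'X_{1..s}).

Lemma exists_set_between T k :
  (#|T| <= k)%N -> (k <= s)%N -> exists2 S : {set 'I_s}, T \subset S & #|S| = k.
Proof.
move=> Tk ks; have [d] := ubnP (k - #|T|)%N.
elim: d => // d IHd in T Tk *; rewrite ltnS => kd.
have [->|ltTk] := eqVneq k #|T|; first by exists T.
have {}ltTk : (#|T| < k)%N by rewrite ltn_neqAle eq_sym ltTk.
have /card_gt0P[x] : (0 < #|~: T|)%N.
  by rewrite cardsCs setCK card_ord subn_gt0 (leq_trans ltTk).
rewrite in_setC => xT; have cx : #|x |: T| = #|T|.+1 by rewrite cardsU1 xT.
have [| |S xTS cS] := IHd (x |: T); rewrite ?cx //; first by lia.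
by exists S => //; apply: subset_trans xTS; apply: subsetUr.
Qed.

Definition multiplicity L : 'X_{1..s} := [multinom (\sum_(A <- L) (i \in A))%N | i < s].

Lemma prod_multiplicity (R : comNzRingType) (u : 'I_s -> R) L :
  \prod_(A <- L) \prod_(i in A) u i = mon u (multiplicity L).
Proof.
rewrite /mon; under [RHS]eq_bigr do rewrite mnmE expr_sum.
rewrite exchange_big; apply: eq_bigr => A _; rewrite big_mkcond.
by apply: eq_bigr => i _; case: (i \in A).
Qed.

Lemma part_deg_multiplicity S L :
  part_deg S (multiplicity L) = (\sum_(A <- L) #|A :&: S|)%N.
Proof.
rewrite /part_deg; under eq_bigr do rewrite mnmE.
rewrite exchange_big; apply: eq_bigr => A _; rewrite -sum1_card big_mkcond /=.
rewrite [RHS]big_mkcond; apply: eq_bigr => i _.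
by rewrite in_setI andbC; case: (i \in S); case: (i \in A).
Qed.

Lemma multiplicity_le_size L i : (multiplicity L i <= size L)%N.
Proof. by rewrite mnmE -sum1_size leq_sum // => A _; case: (i \in A). Qed.

Lemma multiplicity_size L i :
  (forall A, A \in L -> i \in A) -> multiplicity L i = size L.
Proof.
by move=> iL; rewrite mnmE -sum1_size; apply: eq_big_seq => A /iL->.
Qed.

Lemma sorted_bottom L : L != [::] -> sorted (fun A B : {set 'I_s} => B \subset A) L ->
  exists2 T, T \in L & forall A, A \in L -> T \subset A.
Proof.
elim: L => // A [|B L] IHL _ /=.
  by move=> _; exists A; rewrite ?mem_head // => B; rewrite inE => /eqP->.
case/andP=> BA sL; have [//|//|T TL minT] := IHL.
exists T; first by rewrite inE TL orbT.
move=> C; rewrite inE => /orP[/eqP->|]; last exact: minT.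
by apply: subset_trans BA; apply: minT; apply: mem_head.
Qed.

Lemma leq_Sdeg_term S A : #|S| = c -> (c + #|A| - s <= #|A :&: S|)%N.
Proof.
move=> cS; rewrite leq_subLR -cS addnC -cardsUI leq_add2r.
by rewrite -[X in (_ <= X)%N]card_ord max_card.
Qed.

Lemma Sdeg_term_eq S A : #|S| = c -> (s + 1 - c <= #|A|)%N ->
  (#|A :&: S| == c + #|A| - s)%N = (~: S \subset A).
Proof.
move=> cS cA; rewrite -{1}cS [(#|S| + _)%N]addnC -cardsUI.
have leU : (#|A :|: S| <= s)%N by rewrite -[X in (_ <= X)%N]card_ord max_card.
have -> : (~: S \subset A) = (A :|: S == setT).
  by rewrite -subTset -setTD subDset setUC.
have -> : (A :|: S == setT) = (#|A :|: S| == s).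
  by rewrite eqEcard subsetT cardsT card_ord eqn_leq leU.
have := cardsUI A S; rewrite cS => UI.
by apply/eqP/eqP; lia.
Qed.

(** The level sets decrease, so the last condition says that the largest
    multiplicity is attained by at least [s + 1 - c] members. *)
Definition generator_form m L :=
  [/\ forall A, A \in L -> A != set0,
      sorted (fun A B : {set 'I_s} => B \subset A) L,
      Sdeg c L = m
    & forall A, A \in L -> (s + 1 - c <= #|A|)%N].

Lemma generator_form_star m L :
  generator_form m L -> star_exponents c m (multiplicity L).
Proof.
case=> _ _ <- _; apply/forall_inP => S /eqP cS; rewrite part_deg_multiplicity.
by apply: leq_sum => A _; apply: leq_Sdeg_term.
Qed.

Hypotheses (c_gt0 : (0 < c)%N) (c_lt : (c < s)%N).

(** Any [c]-set that contains the complement of the smallest level set meets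
    every level set in the least possible number of members. *)
Lemma generator_form_witness m L : (0 < m)%N -> generator_form m L ->
  exists2 S : {set 'I_s}, #|S| = c & part_deg S (multiplicity L) = m.
Proof.
move=> m0 [L0 sL Lm Lbig].
have Lnil : L != [::].
  by apply: contraTneq m0 => Lnil; rewrite -Lm Lnil /Sdeg big_nil.
have [T TL minT] := sorted_bottom Lnil sL.
have [||S TS cS] := @exists_set_between (~: T) c; last 1 first.
- exists S => //; rewrite part_deg_multiplicity -Lm; apply: eq_big_seq => A AL.
  apply/eqP; rewrite Sdeg_term_eq ?Lbig //; apply: subset_trans (minT A AL).
  by rewrite -setCS setCK.
- have := Lbig T TL; have := cardsC T; rewrite card_ord => *; lia.
- exact: ltnW.
Qed.

(** Each level set meets [S] in the least possible number of members, hence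
    contains the complement of [S]; and the smallest one is too large to miss
    [S]. *)
Lemma generator_form_eq m L S :
    (0 < m)%N -> generator_form m L -> #|S| = c ->
    part_deg S (multiplicity L) = m ->
  (forall j, j \notin S -> multiplicity L j = size L) /\
  exists2 i, i \in S & multiplicity L i = size L.
Proof.
move=> m0 [L0 sL Lm Lbig] cS; rewrite part_deg_multiplicity -{1}Lm /Sdeg => SE.
have LS A : A \in L -> ~: S \subset A.
  move=> AL; rewrite -(Sdeg_term_eq cS (Lbig A AL)) eqn_leq leq_Sdeg_term // andbT.
  move/eqP: SE; apply: contraTT; rewrite -ltnNge => ltA; rewrite neq_ltn orbC.
  rewrite (big_rem A) //= [in X in (_ < X)%N](big_rem A) //= -addSn.
  by rewrite leq_add // leq_sum // => B _; apply: leq_Sdeg_term.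
split=> [j jS|].
  by apply: multiplicity_size => A /LS/subsetP; apply; rewrite in_setC.
have Lnil : L != [::].
  by apply: contraTneq m0 => Lnil; rewrite -Lm Lnil /Sdeg big_nil.
have [T TL minT] := sorted_bottom Lnil sL.
have /card_gt0P[i] : (0 < #|T :&: S|)%N.
  by apply: leq_trans (leq_Sdeg_term T cS); have := Lbig T TL; lia.
rewrite in_setI => /andP[iT iS]; exists i => //.
by apply: multiplicity_size => A /minT/subsetP; apply.
Qed.

(** Both forms have degree at least [m] on [S], which forces equality there.
    Then [S] is of least degree for both, so each of them takes its maximal
    value on [S], and takes it everywhere outside [S]. *)
Lemma generator_form_minimal m L L' S :
    (0 < m)%N -> generator_form m L -> generator_form m L' -> #|S| = c ->
    part_deg S (multiplicity L) = m ->
    (forall i, i \in S -> (multiplicity L' i <= multiplicity L i)%N) ->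
  multiplicity L' = multiplicity L.
Proof.
move=> m0 gL gL' cS Lm leL.
have leL'm : (m <= part_deg S (multiplicity L'))%N.
  by have /forall_inP := generator_form_star gL'; apply; rewrite cS.
have eqS i : i \in S -> multiplicity L' i = multiplicity L i.
  move=> iS; apply/eqP; rewrite eqn_leq leL //=.
  apply: contraTT leL'm; rewrite -!ltnNge -Lm => ltL.
  rewrite !(part_degD1 _ iS) -addSn leq_add // leq_part_deg // => j.
  by rewrite in_setD1 => /andP[_ /leL].
have L'm : part_deg S (multiplicity L') = m by rewrite -Lm; apply: eq_bigr.
have [out [i iS iE]] := generator_form_eq m0 gL cS Lm.
have [out' [i' i'S i'E]] := generator_form_eq m0 gL' cS L'm.
have sizeE : size L' = size L.
  apply/eqP; rewrite eqn_leq -{1}i'E eqS // multiplicity_le_size /=.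
  by rewrite -iE -eqS // multiplicity_le_size.
apply/mnmP => j; have [jS|jS] := boolP (j \in S); first exact: eqS.
by rewrite out // out'.
Qed.

Lemma star_exponents_minimal m e : star_exponents c m e ->
  exists a, [/\ (a <= e)%MM, star_exponents c m a &
    forall i, (0 < a i)%N -> ~~ star_exponents c m (a - U_(i))%MM].
Proof.
have [d] := ubnP (mdeg e); elim: d => // d IHd in e *; rewrite ltnS => ed em.
have [/existsP[i /andP[ei emi]]|min] :=
    boolP [exists i, (0 < e i)%N && star_exponents c m (e - U_(i))%MM].
  have [|a [ae am amin]] := IHd (e - U_(i))%MM _ emi.
    apply: leq_trans ed; rewrite -[in X in (_ <= X)%N](@submK _ U_(i)%MM e) ?lemU //.
    by rewrite mdegD mdeg1 addn1.
  by exists a; split=> //; apply: lepm_trans ae (lem_subr _ _).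
exists e; split=> // [|i ei]; first exact: lepm_refl.
by move: min; rewrite negb_exists => /forallP/(_ i); rewrite ei.
Qed.

Lemma sum_lt_nat k M : (\sum_(t <- iota 0 M) (t < k) = minn k M)%N.
Proof.
rewrite -[M in iota 0 M]subn0 -/(index_iota 0 M).
elim: M => [|M IHM]; first by rewrite big_nil minn0.
by rewrite big_nat_recr //= IHM; lia.
Qed.

(** A minimal exponent vector takes its maximal value at some [i0] and, since
    [i0] lies in a [c]-set [S] of degree exactly [m], also at all members
    outside [S]; otherwise an exchange would give a [c]-set of degree less
    than [m]. *)
Lemma generator_form_below m e : (0 < m)%N -> star_exponents c m e ->
  exists2 L, generator_form m L & (multiplicity L <= e)%MM.
Proof.
move=> m0 /star_exponents_minimal[a [ae am amin]].
have s0 : (0 < s)%N by lia.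
have [i0 imax] : exists i0, forall i, (a i <= a i0)%N.
  by have [i0 _ imax] := @arg_maxnP _ (Ordinal s0) xpredT a isT;
    exists i0 => i; apply: imax.
have [S0 _ cS0] := @exists_set_between set0 c (leq_trans (eq_leq (cards0 _)) isT) (ltnW c_lt).
have ai0 : (0 < a i0)%N.
  have /forall_inP/(_ S0) := am; rewrite cS0 => /(_ (eqxx _)) /(part_degU m0)[i _ ai].
  by apply: leq_trans ai (imax i).
have /forall_inPn[S /eqP cS] := amin i0 ai0; rewrite -ltnNge => ltS.
have leS : (m <= part_deg S a)%N by have /forall_inP := am; apply; rewrite cS.
have aE : (a = (a - U_(i0)) + U_(i0))%MM by rewrite submK ?lemU.
have i0S : i0 \in S.
  apply: contraLR leS => i0S; rewrite -ltnNge {1}aE part_degD.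
  by rewrite [part_deg S U_(_)%MM]big1 ?addn0 // => j jS; rewrite mnm1E;
    case: eqVneq i0S => // ->; rewrite jS.
have Sm : part_deg S a = m.
  apply/eqP; rewrite eqn_leq leS andbT {1}aE part_degD.
  by rewrite part_deg_mnm1 // addn1.
have outS j : j \notin S -> a j = a i0.
  move=> jS; apply/eqP; rewrite eqn_leq imax //= leqNgt; apply/negP => ltj.
  have cS' : #|j |: (S :\ i0)| == c.
    by rewrite cardsU1 in_setD1 (negbTE jS) andbF /= -cS (cardsD1 i0 S) i0S.
  have /forall_inP/(_ _ cS') := am; rewrite (part_degD1 _ (setU11 _ _)).
  rewrite setU1K ?in_setD1 ?(negbTE jS) ?andbF //.
  rewrite leqNgt -[X in (_ < X)%N]Sm (part_degD1 _ i0S) ltn_add2r.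
  by rewrite ltj.
pose L := [seq [set i | t < a i]%N | t <- iota 0 (a i0)].
have LA A : A \in L -> i0 \in A /\ ~: S \subset A.
  case/mapP=> t; rewrite mem_iota => /andP[_ ta] ->; rewrite inE; split=> //.
  by apply/subsetP => j; rewrite in_setC inE => /outS->.
have Lbig A : A \in L -> (s + 1 - c <= #|A|)%N.
  case/LA=> i0A SA; have : (#|i0 |: ~: S| <= #|A|)%N.
    by apply: subset_leq_card; rewrite subUset sub1set i0A.
  rewrite cardsU1 in_setC i0S /= add1n (cardsCs (~: S)) setCK card_ord cS.
  by rewrite addn1 subSn // ltnW.
have LE : multiplicity L = a.
  apply/mnmP => i; rewrite mnmE big_map.
  under eq_bigr do rewrite inE.
  by rewrite sum_lt_nat; apply/minn_idPl; apply: imax.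
exists L; last by rewrite LE.
split=> //.
- by move=> A /LA[i0A _]; apply/set0Pn; exists i0.
- apply: (homo_sorted (e := leq)); last exact: iota_sorted.
  by move=> t t' tt'; apply/subsetP => i; rewrite !inE; apply: leq_ltn_trans.
- rewrite -Sm -LE part_deg_multiplicity /Sdeg; apply: eq_big_seq => A AL.
  by apply/eqP; rewrite eq_sym Sdeg_term_eq ?Lbig //; case/LA: AL.
Qed.

End NormalForms.

(** * Minimal generators *)

Section RegularSequences.

Variables (R : comNzRingType) (s c : nat) (u : 'I_s -> R).
Hypothesis c_lt : (c < s)%N.
Hypothesis u_seq : forall t : seq 'I_s, uniq t -> size t = c.+1 ->
  regular_sequence [seq u i | i <- t].
Implicit Types V : {set 'I_s}.

(* The hypothesis is about ordered sequences of length exactly [c + 1]: the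
   elements of [V] come first, then [j], then any others. *)
Lemma complete_sequence V j : (#|V| <= c)%N -> j \notin V ->
  exists t, uniq (enum V ++ j :: t) /\ size (enum V ++ j :: t) = c.+1.
Proof.
move=> cV jV; pose r := enum (~: (j |: V)).
have sr : (c - #|V| <= size r)%N.
  by rewrite -cardE (cardsCs (~: _)) setCK card_ord cardsU1 jV; lia.
exists (take (c - #|V|) r); split; last first.
  by rewrite size_cat /= size_takel // -cardE addnS subnKC.
have rV i : i \in take (c - #|V|) r -> i \notin j |: V.
  by move/mem_take; rewrite mem_enum in_setC.
rewrite cat_uniq /= enum_uniq take_uniq ?enum_uniq // andbT negb_or mem_enum jV /=.
apply/andP; split; last by apply/negP => /rV; rewrite setU11.
apply/hasPn => i /rV; rewrite mem_enum; apply: contra => iV.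
by rewrite in_setU1 iV orbT.
Qed.

Lemma regular_sequence_family : regular_family u c.
Proof.
move=> V j f cV jV.
have [t [tU tS]] := complete_sequence cV jV.
have [/(_ #|V| f) reg _] := u_seq tU tS.
have takeE : take #|V| [seq u i | i <- enum V ++ j :: t] = [seq u i | i <- enum V].
  by rewrite map_cat take_size_cat // size_map -cardE.
have nthE : [seq u i | i <- enum V ++ j :: t]`_#|V| = u j.
  by rewrite map_cat nth_cat size_map -cardE ltnn subnn.
have genE g : vars_ideal u V g <-> ideal_gen (fun h => h \in [seq u i | i <- enum V]) g.
  apply: iff_trans (vars_idealP u V g) _.
  split; apply: ideal_gen_mono => h.
    by case=> i iV ->; apply: map_f; rewrite mem_enum.
  by case/mapP=> i; rewrite mem_enum => iV ->; exists i.
move/genE; rewrite mulrC => uf; apply/genE.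
move: reg; rewrite takeE nthE size_map tS ltnS; exact.
Qed.

Lemma vars_ideal_proper V : (#|V| <= c)%N -> ~ vars_ideal u V 1.
Proof.
move=> cV /vars_idealP V1.
have /card_gt0P[j] : (0 < #|~: V|)%N.
  by rewrite (cardsCs (~: V)) setCK card_ord subn_gt0 (leq_ltn_trans cV).
rewrite in_setC => jV; have [t [tU tS]] := complete_sequence cV jV.
have [_] := u_seq tU tS; apply; move: V1; apply: ideal_gen_mono => _ [i iV ->].
by apply: map_f; rewrite mem_cat mem_enum iV.
Qed.

Lemma symbolic_generatorsP m M : symbolic_generators c u m M <->
  exists2 L, generator_form c m L & M = mon u (multiplicity L).
Proof.
split=> [[_ [L [[L0 sL ->] Lm Lbig]]]|[L [L0 sL Lm Lbig] ->]].
  by exists L; [split|rewrite prod_multiplicity].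
split; last by exists L; split=> //; split=> //; rewrite prod_multiplicity.
exists (flatten [seq enum A | A : {set 'I_s} <- L]); rewrite -prod_multiplicity.
rewrite big_flatten big_map; apply: eq_bigr => A _.
by rewrite big_enum.
Qed.

Hypothesis c_gt0 : (0 < c)%N.

Lemma symbolic_generators_gen m f : (0 < m)%N ->
  mon_ideal u (star_exponents c m) f <-> ideal_gen (symbolic_generators c u m) f.
Proof.
move=> m0; split; move: f.
  apply: mon_ideal_least; first exact: ideal_gen_is_ideal.
  move=> e /(generator_form_below c_gt0 c_lt m0)[L gL leL].
  rewrite (mon_split u leL).
  case: (ideal_gen_is_ideal (symbolic_generators c u m)) => _ _; apply.
  by apply: ideal_gen_base; apply/symbolic_generatorsP; exists L.
apply: ideal_gen_mono => _ /symbolic_generatorsP[L gL ->].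
by exists (multiplicity L) => //; apply: generator_form_star.
Qed.

(** On a [c]-set [S] of least degree for [g], no other generator has exponents
    bounded by those of [g]. As the members of [S] behave like variables, a
    combination of generators that equals [g] must involve [g] itself. *)
Lemma symbolic_generators_irredundant m (H : R -> Prop) g :
    (0 < m)%N -> (forall h, H h -> symbolic_generators c u m h) ->
    symbolic_generators c u m g -> ideal_gen H g ->
  H g.
Proof.
move=> m0 HG /symbolic_generatorsP[L gL ->] Hg.
have [S cS Sm] := generator_form_witness c_gt0 c_lt m0 gL.
pose below e L' := [/\ generator_form c m L', H (mon u (multiplicity L')) &
  forall i, i \in S -> (multiplicity L' i <= e i)%N].
pose K e : bool := excluded_middle_informative (exists L', below e L').
have KP e : reflect (exists L', below e L') (K e).
  by rewrite /K; case: excluded_middle_informative => ?; constructor.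
have upK : upper_on S K.
  move=> e e' ee' /KP[L' [gL' HL' leL']]; apply/KP; exists L'; split=> // i iS.
  exact: leq_trans (leL' i iS) (ee' i iS).
have Kg : mon_ideal u K (mon u (multiplicity L) * 1).
  rewrite mulr1; move: Hg; apply: ideal_gen_mono => h Hh.
  have /symbolic_generatorsP[L' gL' hE] := HG h Hh.
  exists (multiplicity L') => //; apply/KP; exists L'; split=> //.
  by rewrite -hE.
have [/KP[L' [gL' HL' leL']]|nK] := boolP (K (multiplicity L)).
  by rewrite -(generator_form_minimal c_gt0 c_lt m0 gL gL' cS Sm leL').
have cS' : (#|S| <= c)%N by rewrite cS.
by case: (vars_ideal_proper cS'); apply: (mon_ideal_coef regular_sequence_family cS' upK nK).
Qed.

End RegularSequences.

Theorem theorem4p9 (k : fieldType) (n c s : nat)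
    (F : 'I_s -> {mpoly k[n.+1]})
    (hc : (1 <= c)%N) (hcs : (c < s)%N)
    (F_inj : injective F)
    (F_form : forall i, exists d : nat, F i \is d.-homog)
    (F_reg : forall t : seq 'I_s, uniq t -> size t = c.+1 ->
       regular_sequence [seq F i | i <- t])
    (m : nat) (hm : (1 <= m)%N) :
  minimal_generating_set
    (symbolic_power (codim_ideal c F) m)
    (symbolic_generators c F m).
Proof.
have genE f : symbolic_power (codim_ideal c F) m f <->
    ideal_gen (symbolic_generators c F m) f.
  apply: iff_trans (symbolic_generators_gen F hcs hc f hm).
  apply: symbolic_power_star; first exact: regular_sequence_family hcs F_reg.
  by move=> J r; apply: exists_associated_prime.
split=> // H HG HE g Gg.
apply: (symbolic_generators_irredundant hcs F_reg hc hm HG Gg).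
by apply/HE/genE; apply: ideal_gen_base.
Qed.
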